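(* Let $T_1>0$, let $n\ge 1$ be an integer, let $r$ be real with $0\le r<T_1$, and put $T_2=nT_1+r$. Let $\delta>0$ and let $m\ge1$ be an integer. For an integer $l\ge 1$ consider the (max,+) recursion $$x_1(k)=\max\bigl(T_1+x_1(k-1),\;T_1+T_2+x_1(k-(l+1))\bigr),$$ rewritten as the first-order system $$x_1(k)=\max\bigl(T_1+x_1(k-1),\;r+T_1+z_l(k-1)\bigr),\qquad z_i(k)=\tfrac{n}{l}T_1+z_{i-1}(k-1)\ (1\le i\le l),\qquad z_0(k):=x_1(k),$$ together with the separate system $y_i(k)=\delta+y_{i-1}(k-1)$ for $1\le i\le m$ and $y_0(k)=\delta+y_m(k-1)$. Then the maximum cycle mean of the precedence graph of the $y$-system is $\lambda_2=\delta$, and the maximum cycle mean of the precedence graph of the $(x_1,z_1,\dots,z_l)$-system is $$\lambda_1=\begin{cases}T_1 & \text{if } l>n,\\[2pt] \dfrac{(n+1)T_1+r}{l+1} & \text{if } l\le n.\end{cases}$$ In particular, the minimum possible value of $\lambda_1$ over integers $l\ge1$ is $T_1$, and it is attained for every $l>n$.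
   Context: The (max,+) semiring is $\mathbb{R}\cup\{-\infty\}$ with $a\oplus b=\max(a,b)$ and $a\otimes b=a+b$. A first-order linear (max,+) system $X(k)=A\otimes X(k-1)$ means $X_i(k)=\max_j (A_{ij}+X_j(k-1))$. The precedence graph of $A$ has one node per coordinate and an edge $(i,j)$ of weight $A_{ji}$ whenever $A_{ji}\ne-\infty$. The maximum cycle mean is the maximum over all (directed) circuits of (sum of edge weights)/(number of edges). For an irreducible matrix this is its unique (max,+) eigenvalue, i.e. the unique $\lambda$ with $A\otimes X=\lambda\otimes X$ for some eigenvector $X$. With coordinates ordered $(x_1,z_l,z_{l-1},\dots,z_1)$, the $(l+1)\times(l+1)$ matrix of the $(x_1,z)$-system has $A_{1,1}=T_1$, $A_{1,2}=T_1+r$, $A_{i,i+1}=nT_1/l$ for $2\le i\le l$, $A_{l+1,1}=nT_1/l$, and all other entries $-\infty$. *)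

(* Defs.v *)
From mathcomp Require Import all_boot all_order all_algebra.
From mathcomp Require Import reals constructive_ereal.

Set Implicit Arguments.
Unset Strict Implicit.
Unset Printing Implicit Defensive.

Import Order.TTheory GRing.Theory Num.Theory.
Local Open Scope ring_scope.
Local Open Scope ereal_scope.

(* The (max,+) semiring R u {-oo} is rendered by the extended reals \bar R,
   with oplus = maxe and otimes = +.  Since -oo + x = -oo for every x,
   including x = +oo, -oo is absorbing for otimes.  No matrix below has an
   entry +oo. *)

Section MaxPlus.
Variables (R : realType) (N : nat).
Implicit Types (A : 'M[\bar R]_N) (c : seq 'I_N).

Definition mp_mulmx A (X : 'cV[\bar R]_N) : 'cV[\bar R]_N :=
  \col_i \big[maxe/-oo]_j (A i j + X j ord0).

Definition mp_linear_system A (X : int -> 'cV[\bar R]_N) : Prop :=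
  forall k : int, X k = mp_mulmx A (X (k - 1)%R).

(* The arc from i to j carries the transposed coefficient A j i. *)
Definition prec_edge A : rel 'I_N := fun i j => A j i != -oo.

(* A circuit is a nonempty closed walk, given by its successive nodes; the arc
   from the last node back to the first one is implicit, and nodes may be
   repeated.  A circuit with node sequence c has size c arcs, listed by
   zip c (rot 1 c). *)
Definition circuit A c : bool := (c != [::]) && cycle (prec_edge A) c.

Definition circuit_weight A c : \bar R :=
  \sum_(e <- zip c (rot 1 c)) A e.2 e.1.

Definition circuit_mean A c : \bar R :=
  circuit_weight A c * ((size c)%:R^-1)%:E.

Definition is_max_cycle_mean A (lambda : R) : Prop :=
  (exists2 c, circuit A c & circuit_mean A c = lambda%:E) /\
  (forall c, circuit A c -> circuit_mean A c <= lambda%:E).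

End MaxPlus.

Section Systems.
Variable R : realType.


Definition x_recursion (T1 T2 : R) (l : nat) (x1 : int -> \bar R) : Prop :=
  forall k : int,
    x1 k = maxe (T1%:E + x1 (k - 1)%R)
                (T1%:E + T2%:E + x1 (k - (l.+1)%:Z)%R).

(* z_0 := x_1; the value of z at 0 is ignored. *)
Definition z_ext (x1 : int -> \bar R) (z : nat -> int -> \bar R) (i : nat) :
    int -> \bar R :=
  if i == 0%N then x1 else z i.

Definition x_system (T1 r : R) (n l : nat) (x1 : int -> \bar R)
    (z : nat -> int -> \bar R) : Prop :=
  forall k : int,
    x1 k = maxe (T1%:E + x1 (k - 1)%R) (r%:E + T1%:E + z_ext x1 z l (k - 1)%R)
    /\ (forall i : nat, (1 <= i <= l)%N ->
          z_ext x1 z i k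
          = (n%:R / l%:R * T1)%:E + z_ext x1 z i.-1 (k - 1)%R).

(* Coordinates are ordered (x_1, z_l, z_(l-1), ..., z_1), indexed from 0. *)
Definition x_state (l : nat) (x1 : int -> \bar R) (z : nat -> int -> \bar R)
    (k : int) : 'cV[\bar R]_l.+1 :=
  \col_(i < l.+1) if (i : nat) == 0%N then x1 k else z (l.+1 - i)%N k.

Definition x_matrix (T1 r : R) (n l : nat) : 'M[\bar R]_l.+1 :=
  \matrix_(i < l.+1, j < l.+1)
    if ((i : nat) == 0%N) && ((j : nat) == 0%N) then T1%:E
    else if ((i : nat) == 0%N) && ((j : nat) == 1%N) then (T1 + r)%:E
    else if (1 <= i < l)%N && ((j : nat) == i.+1) then (n%:R * T1 / l%:R)%:E
    else if ((i : nat) == l) && ((j : nat) == 0%N) then (n%:R * T1 / l%:R)%:E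
    else -oo.

Definition y_system (delta : R) (m : nat) (y : nat -> int -> \bar R) : Prop :=
  forall k : int,
    (forall i : nat, (1 <= i <= m)%N -> y i k = delta%:E + y i.-1 (k - 1)%R)
    /\ y 0%N k = delta%:E + y m (k - 1)%R.

(* Coordinates are ordered (y_0, y_1, ..., y_m). *)
Definition y_state (m : nat) (y : nat -> int -> \bar R) (k : int) :
    'cV[\bar R]_m.+1 :=
  \col_(i < m.+1) y i k.

Definition y_matrix (delta : R) (m : nat) : 'M[\bar R]_m.+1 :=
  \matrix_(i < m.+1, j < m.+1)
    if (1 <= i)%N && ((j : nat) == i.-1) then delta%:E
    else if ((i : nat) == 0%N) && ((j : nat) == m) then delta%:E
    else -oo.

End Systems.

(* Main.v *)
Require Import Defs.
From mathcomp Require Import all_boot all_order all_algebra.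
From mathcomp Require Import reals constructive_ereal.
From mathcomp Require Import ring lra zify.

Set Implicit Arguments.
Unset Strict Implicit.
Unset Printing Implicit Defensive.

Import Order.TTheory GRing.Theory Num.Theory.
Local Open Scope ring_scope.

(** Both maximum cycle means come from a potential (a dual certificate).  If
[v] assigns a real number to each node and every arc from [i] to [j] has weight
at most [lambda + (v j - v i)], then along a circuit the differences of [v]
cancel, so that the circuit has mean at most [lambda]; a circuit all of whose
arcs reach the bound has mean exactly [lambda]
([is_max_cycle_mean_potential]).  Such a [v] amounts to a finite
(max,+)-subeigenvector for [lambda].

In the graph of the [y]-system all arcs have weight [delta], so [v = 0] works
and any circuit is tight.  In the graph of the [(x_1, z)]-system, write
[c = n T1 / l].  There are only two elementary circuits: the loop at [x_1], of
mean [T1], and the Hamiltonian circuit [x_1 -> z_1 -> ... -> z_l -> x_1], with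
[l] arcs of weight [c] and one of weight [T1 + r], hence of mean
[((n + 1) T1 + r) / (l + 1)].  The potential [v(x_1) = 0],
[v(z_i) = i (c - lambda)] makes the arcs of weight [c] tight; the loop and the
closing arc then require exactly that [lambda] is at least each of the two
means ([x_arc_le_potential]), and the larger mean is attained.  As
[0 <= r < T1], the loop wins if [l > n] and the long circuit if [l <= n].

The recursion and the first-order system are equivalent because unfolding the
[z_i] gives [z_i(k) = i c + x_1(k - i)] ([x_system_unfold]), so that [z_l]
delays [x_1] by [l] steps and adds [l c = n T1] ([x_recursionP]).  For the
matrix forms, each row has its finite entries at the cyclic successor
(for [x_matrix]) or predecessor (for [y_matrix]) of its index, apart from the
loop of [x_matrix] at index 0 ([x_matrixE], [y_matrixE]). *)

(** * Sums along a closed walk *)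

Lemma mulr_succl (R : pzRingType) (k : nat) (x : R) :
  k.+1%:R * x = k%:R * x + x.
Proof. by rewrite -natr1 mulrDl mul1r. Qed.

Lemma path_rcons_zip (T : Type) (e : rel T) (x y : T) (p : seq T) :
  path e x (rcons p y) = all (fun a => e a.1 a.2) (zip (x :: p) (rcons p y)).
Proof. by elim: p x => [|z p IHp] x //=; rewrite IHp. Qed.

Lemma cycle_zip (T : Type) (e : rel T) (c : seq T) :
  cycle e c = all (fun a => e a.1 a.2) (zip c (rot 1 c)).
Proof. by case: c => [|x p] //; rewrite rot1_cons -path_rcons_zip. Qed.

(** The heads of the arcs of a closed walk are a rotation of their tails. *)
Lemma big_zip_telescope (V : zmodType) (T : eqType) (v : T -> V) (c : seq T) :
  \sum_(a <- zip c (rot 1 c)) (v a.2 - v a.1) = 0.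
Proof.
rewrite sumrB -(big_map snd xpredT v) -(big_map fst xpredT v).
rewrite -/(unzip2 _) -/(unzip1 _) unzip2_zip ?unzip1_zip ?size_rot //.
by rewrite (perm_big c) ?subrr // perm_rot.
Qed.

(** * Potentials and cycle means *)

Section Potential.
Variables (R : realType) (N : nat) (A : 'M[\bar R]_N).
Variables (lambda : R) (v : 'I_N -> R).

Let potential_weight (a : 'I_N * 'I_N) : R := lambda + (v a.2 - v a.1).

Lemma potential_mean (c : seq 'I_N) : c != [::] ->
  ((\sum_(a <- zip c (rot 1 c)) (potential_weight a)%:E) * ((size c)%:R^-1)%:E
   = lambda%:E)%E.
Proof.
move=> c0; rewrite sumEFin big_split /= big_zip_telescope addr0.
rewrite big_const_seq count_predT size_zip size_rot minnn iter_addr_0.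
by rewrite -EFinM -[lambda *+ _]mulr_natr mulfK // pnatr_eq0 size_eq0.
Qed.

Lemma circuit_mean_le (c : seq 'I_N) :
    (forall i j, prec_edge A i j ->
       (A j i <= (potential_weight (i, j))%:E)%E) ->
  circuit A c -> (circuit_mean A c <= lambda%:E)%E.
Proof.
move=> leA /andP[c0]; rewrite cycle_zip => /allP cA.
rewrite -(potential_mean c0) /circuit_mean.
apply: lee_wpmul2r; first by rewrite lee_fin invr_ge0.
rewrite /circuit_weight big_seq [leRHS]big_seq.
by apply: lee_sum => -[i j] /cA; apply: leA.
Qed.

Lemma circuit_mean_tight (c : seq 'I_N) :
    c != [::] ->
    cycle (fun i j => A j i == (potential_weight (i, j))%:E) c ->
  circuit A c /\ circuit_mean A c = lambda%:E.
Proof.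
move=> c0 tight; split.
  apply/andP; split=> //; apply: sub_cycle tight => i j.
  by rewrite /prec_edge => /eqP ->.
move: tight; rewrite cycle_zip -(potential_mean c0) => /allP tight.
rewrite /circuit_mean /circuit_weight; congr (_ * _)%E.
by apply: eq_big_seq => -[i j] /tight /eqP.
Qed.

Lemma is_max_cycle_mean_potential (c : seq 'I_N) :
    (forall i j, prec_edge A i j ->
       (A j i <= (potential_weight (i, j))%:E)%E) ->
    c != [::] -> cycle (fun i j => A j i == (potential_weight (i, j))%:E) c ->
  is_max_cycle_mean A lambda.
Proof.
move=> leA c0 /(circuit_mean_tight c0)[cA cE]; split; first by exists c.
by move=> d; apply: circuit_mean_le.
Qed.

End Potential.

(** * The cyclic enumeration of the nodes *)

Section Hamiltonian.
Variable N : nat.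

(** As a [traject], rather than an [enum], it is a path of [ordS] by
construction. *)
Definition ord_cycle : seq 'I_N.+1 := traject (@ordS N.+1) ord0 N.+1.

Lemma val_iter_ordS k : val (iter k (@ordS N.+1) ord0) = (k %% N.+1)%N.
Proof.
by elim: k => [|k IHk] /=; rewrite ?mod0n // IHk -addn1 modnDml addn1.
Qed.

Lemma cycle_ord_cycle (e : rel 'I_N.+1) :
  (forall i, e i (ordS i)) -> cycle e ord_cycle.
Proof.
move=> eS; rewrite /ord_cycle trajectS /=.
have -> : rcons (traject (@ordS N.+1) (ordS ord0) N) ord0
          = traject (@ordS N.+1) (ordS ord0) N.+1.
  rewrite trajectSr; congr rcons; apply: val_inj.
  by rewrite -iterSr val_iter_ordS modnn.
by apply: sub_path (fpath_traject _ _ _) => i j /eqP <-.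
Qed.

End Hamiltonian.

(** * The y-system *)

Section YSystem.
Variables (R : realType) (delta : R) (m : nat).

Lemma y_matrixE i j :
  y_matrix delta m i j = if j == ord_pred i then delta%:E else -oo%E.
Proof.
rewrite mxE -val_eqE /=.
case: i => [[|i] lt_i] /=.
  by rewrite modn_small.
by rewrite modnDr modn_small // ltnW.
Qed.

Lemma y_row X i :
  mp_mulmx (y_matrix delta m) X i ord0 = (delta%:E + X (ord_pred i) ord0)%E.
Proof.
rewrite mxE (bigD1 (ord_pred i)) //= y_matrixE eqxx big1 ?maxeNy // => j neq.
by rewrite y_matrixE (negPf neq) addNye.
Qed.

Lemma y_systemP (y : nat -> int -> \bar R) :
  y_system delta m y <->
  mp_linear_system (y_matrix delta m) (y_state m y).
Proof.
split=> [yP k|yP k].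
  apply/colP => i; rewrite y_row !mxE /=.
  have [yS y0] := yP k; case: i => [[|i] lt_i] /=.
    by rewrite modn_small.
  by rewrite modnDr modn_small ?yS // ltnW.
have rowP (i : 'I_m.+1) : y i k = (delta%:E + y (ord_pred i) (k - 1)%R)%E.
  by have /colP/(_ i) := yP k; rewrite y_row !mxE.
split=> [i /andP[i_gt0 le_im]|]; last first.
  by rewrite (rowP ord0) /= modn_small.
case: i i_gt0 le_im => // i _ lt_im.
rewrite (rowP (Ordinal (lt_im : (i.+1 < m.+1)%N))) /=.
by rewrite modnDr modn_small // ltnW.
Qed.

Lemma y_max_cycle_mean : is_max_cycle_mean (y_matrix delta m) delta.
Proof.
apply: (@is_max_cycle_mean_potential _ _ _ _ (fun=> 0) (ord_cycle m)) => //.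
  move=> i j; rewrite /prec_edge y_matrixE subrr addr0.
  by case: ifP; rewrite ?lexx ?eqxx.
apply: cycle_ord_cycle => i.
by rewrite y_matrixE ordSK eqxx subrr addr0.
Qed.

End YSystem.

(** * The (x_1, z)-system *)

Section XSystem.
Variables (R : realType) (T1 r : R) (n l : nat).
Hypothesis l_gt0 : (0 < l)%N.

Let c : R := n%:R * T1 / l%:R.

Let delayM : l%:R * c = n%:R * T1.
Proof. by rewrite mulrC divfK // pnatr_eq0 -lt0n. Qed.

Let delayE : n%:R / l%:R * T1 = c.
Proof. by rewrite mulrAC. Qed.

(** Each [z_i] is a delay line: going from [z_(i-1)] to [z_i] costs one time
step and adds [c], down to [z_0 = x_1]. *)
Lemma x_system_unfold (x1 : int -> \bar R) z i k :
    x_system T1 r n l x1 z -> (i <= l)%N ->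
  z_ext x1 z i k = ((i%:R * c)%:E + x1 (k - i%:Z)%R)%E.
Proof.
move=> xP; elim: i k => [|i IHi] k le_il; first by rewrite mul0r add0e subr0.
rewrite (proj2 (xP k)) // IHi 1?ltnW // delayE addeA -EFinD.
rewrite [c + _]addrC -mulr_succl.
by congr (_ + x1 _)%E; lia.
Qed.

Lemma x_recursionP (T2 : R) (x1 : int -> \bar R) : T2 = n%:R * T1 + r ->
  x_recursion T1 T2 l x1 <-> exists z, x_system T1 r n l x1 z.
Proof.
move=> T2E.
have delayed k :
    (r%:E + T1%:E + ((l%:R * c)%:E + x1 (k - 1 - l%:Z)%R))%E
    = (T1%:E + T2%:E + x1 (k - l.+1%:Z)%R)%E.
  by rewrite delayM addeA -!EFinD T2E; congr (_%:E + x1 _)%E; [ring | lia].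
split=> [xP|[z xP] k]; last first.
  by rewrite (proj1 (xP k)) (x_system_unfold _ xP (leqnn l)) delayed.
pose z (i : nat) k := ((i%:R * c)%:E + x1 (k - i%:Z)%R)%E.
have zE i k : z_ext x1 z i k = z i k.
  by case: i => [|i] //; rewrite /z /z_ext /= mul0r add0e subr0.
exists z => k; rewrite zE delayed -xP; split=> // -[|i] // _.
rewrite !zE /z /= delayE addeA -EFinD [c + _]addrC -mulr_succl.
by congr (_ + x1 _)%E; lia.
Qed.

Lemma x_matrixE i j :
  x_matrix T1 r n l i j =
    if j == ordS i then (if i == ord0 then T1 + r else c)%:E
    else if (i == ord0) && (j == ord0) then T1%:E else -oo%E.
Proof.
rewrite mxE -!val_eqE /=.
case: i j => [[|i] lt_i] [j lt_j] /=.
  rewrite modn_small ?ltnS //.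
  by case: j lt_j => [|[|j]] //= _; rewrite andbF.
have [lt_il|le_li] := ltnP i.+1 l.
  by rewrite modn_small ?ltnS // (ltn_eqF lt_il).
have -> : i.+1 = l by apply/eqP; rewrite eqn_leq le_li -ltnS lt_i.
by rewrite modnn eqxx.
Qed.

Lemma ord0_ordS_eqF : (ord0 == @ordS l.+1 ord0) = false.
Proof. by rewrite -val_eqE /= modn_small. Qed.

Lemma x_row0 X :
  mp_mulmx (x_matrix T1 r n l) X ord0 ord0 =
  maxe (T1%:E + X ord0 ord0)%E ((T1 + r)%:E + X (ordS ord0) ord0)%E.
Proof.
rewrite mxE (bigD1 ord0) //= (bigD1 (ordS ord0)) 1?eq_sym ?ord0_ordS_eqF //= big1.
  by rewrite !x_matrixE !eqxx ord0_ordS_eqF maxeNy.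
by move=> j /andP[j0 jS]; rewrite x_matrixE (negPf j0) (negPf jS) addNye.
Qed.

Lemma x_rowS X i : i != ord0 ->
  mp_mulmx (x_matrix T1 r n l) X i ord0 = (c%:E + X (ordS i) ord0)%E.
Proof.
move=> /negPf i0; rewrite mxE (bigD1 (ordS i)) //= x_matrixE eqxx i0.
rewrite big1 ?maxeNy // => j /negPf jS.
by rewrite x_matrixE i0 jS addNye.
Qed.

Lemma x_state_ordS (x1 : int -> \bar R) z k (i : 'I_l.+1) :
  x_state l x1 z k (ordS i) ord0 = z_ext x1 z (l - i) k.
Proof.
rewrite mxE /=; case: i => i /=; rewrite ltnS leq_eqVlt => /orP[/eqP->|lt_il].
  by rewrite modnn subnn.
by rewrite modn_small ?ltnS //= /z_ext subn_eq0 leqNgt lt_il subSS.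
Qed.

Lemma x_state_neq0 (x1 : int -> \bar R) z k (i : 'I_l.+1) : i != ord0 ->
  x_state l x1 z k i ord0 = z_ext x1 z (l.+1 - i) k.
Proof.
by rewrite -val_eqE mxE /= => /negPf ->; rewrite /z_ext subn_eq0 leqNgt ltn_ord.
Qed.

Lemma x_systemP (x1 : int -> \bar R) (z : nat -> int -> \bar R) :
  x_system T1 r n l x1 z <->
  mp_linear_system (x_matrix T1 r n l) (x_state l x1 z).
Proof.
split=> [xP k|xP k].
  have [x0 xS] := xP k.
  apply/colP => i; have [->|i0] := eqVneq i ord0.
    by rewrite x_row0 x_state_ordS !mxE /= subn0 x0 -EFinD [T1 + r]addrC.
  rewrite x_rowS // x_state_ordS x_state_neq0 // xS ?delayE.
    by congr (_ + z_ext x1 z _ _)%E; lia.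
  by move: i0 (ltn_ord i); rewrite -val_eqE /=; lia.
split=> [|i /andP[i_gt0 le_il]].
  have /colP/(_ ord0) := xP k.
  by rewrite x_row0 x_state_ordS !mxE /= subn0 -EFinD [T1 + r]addrC.
have lt_j : (l.+1 - i < l.+1)%N by lia.
have j0 : Ordinal lt_j != ord0 by rewrite -val_eqE /=; lia.
have /colP/(_ (Ordinal lt_j)) := xP k.
rewrite x_state_neq0 // x_rowS // x_state_ordS /= delayE.
have -> : (l.+1 - (l.+1 - i) = i)%N by lia.
by have -> : (l - (l.+1 - i) = i.-1)%N by lia.
Qed.

(** The node of index [i > 0] is [z_(l+1-i)], at distance [l + 1 - i] from [x_1]
along arcs of weight [c]; [v] accumulates the excess [c - lambda] of these
arcs. *)
Let v (lambda : R) (i : 'I_l.+1) : R :=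
  if i == ord0 then 0 else (l.+1 - i)%:R * (c - lambda).

Let v_ordS lambda i : v lambda (ordS i) = (l - i)%:R * (c - lambda).
Proof.
rewrite /v -val_eqE /=; case: i => i /=; rewrite ltnS leq_eqVlt.
case/orP=> [/eqP->|lt_il]; first by rewrite modnn subnn mul0r.
by rewrite modn_small ?ltnS //= subSS.
Qed.

(** The nodes of index [i != 0] receive the arcs of weight [c]. *)
Let tight_arc lambda i : i != ord0 ->
  lambda + (v lambda i - v lambda (ordS i)) = c.
Proof.
move=> i0; have le_il : (i <= l)%N by rewrite -ltnS.
by rewrite v_ordS /v (negPf i0) subSn // mulr_succl; ring.
Qed.

(** For the arc from [z_l] back to [x_1], whose weight is [T1 + r], the bound
is all of [(l + 1) lambda] minus the total weight [l c = n T1] of the other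
arcs of the Hamiltonian circuit. *)
Let closing_arc lambda :
  lambda + (v lambda ord0 - v lambda (ordS ord0))
  = l.+1%:R * lambda - n%:R * T1.
Proof. by rewrite v_ordS /v eqxx subn0 -delayM mulr_succl; ring. Qed.

(** The two hypotheses say that [lambda] is at least the mean of the loop and
at least the mean of the Hamiltonian circuit; they bound the loop and the
closing arc respectively, the other arcs being tight for every [lambda]. *)
Lemma x_arc_le_potential lambda i j :
    T1 <= lambda -> n.+1%:R * T1 + r <= l.+1%:R * lambda ->
    prec_edge (x_matrix T1 r n l) i j ->
  (x_matrix T1 r n l j i <= (lambda + (v lambda j - v lambda i))%:E)%E.
Proof.
move=> leT le_long; rewrite /prec_edge x_matrixE.
have [->|_] := eqVneq i (ordS j).
  have [->|j0] := eqVneq j ord0; last by rewrite tight_arc.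
  by rewrite closing_arc lee_fin; move: le_long; rewrite mulr_succl; lra.
by have [/andP[/eqP-> /eqP->] _|] := ifP; rewrite ?eqxx // subrr addr0 lee_fin.
Qed.

Lemma x_max_cycle_mean_of_loop : n.+1%:R * T1 + r <= l.+1%:R * T1 ->
  is_max_cycle_mean (x_matrix T1 r n l) T1.
Proof.
move=> le_long.
apply: (@is_max_cycle_mean_potential _ _ _ _ (v T1) [:: ord0]) => //.
  by move=> i j; apply: x_arc_le_potential.
by rewrite /= x_matrixE ord0_ordS_eqF !eqxx subrr addr0 eqxx.
Qed.

Lemma x_max_cycle_mean_of_hamiltonian : l.+1%:R * T1 <= n.+1%:R * T1 + r ->
  is_max_cycle_mean (x_matrix T1 r n l) ((n.+1%:R * T1 + r) / l.+1%:R).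
Proof.
set lambda := _ / _ => le_long.
have lambdaM : l.+1%:R * lambda = n.+1%:R * T1 + r.
  by rewrite mulrC divfK // pnatr_eq0.
apply: (@is_max_cycle_mean_potential _ _ _ _ (v lambda) (rev (ord_cycle l))).
- move=> i j; apply: x_arc_le_potential; last by rewrite lambdaM.
  by rewrite ler_pdivlMr ?ltr0n // mulrC.
- by rewrite -size_eq0 size_rev size_traject.
(* The arcs go from [ordS i] to [i], hence the reversed enumeration. *)
rewrite rev_cycle; apply: cycle_ord_cycle => i; rewrite x_matrixE eqxx.
have [->|i0] := eqVneq i ord0; last by rewrite tight_arc.
by rewrite closing_arc lambdaM mulr_succl; apply/eqP; congr _%:E; ring.
Qed.

(** The loop at [x_1] is a circuit of mean [T1]; on it every potential is
tight. *)
Lemma x_max_cycle_mean_ge lambda :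
  is_max_cycle_mean (x_matrix T1 r n l) lambda -> T1 <= lambda.
Proof.
move=> [_ ub]; rewrite -lee_fin.
have [loopA loopE] :
    circuit (x_matrix T1 r n l) [:: ord0] /\
    circuit_mean (x_matrix T1 r n l) [:: ord0] = T1%:E.
  apply: (circuit_mean_tight (v := fun=> 0)) => //=.
  by rewrite x_matrixE ord0_ordS_eqF !eqxx subrr addr0 eqxx.
by rewrite -loopE; apply: ub.
Qed.

End XSystem.

(** * The theorem *)

Theorem mainTheorem1 (R : realType) (T1 r T2 delta : R) (n m : nat)
    (hT1 : 0 < T1) (hn : (1 <= n)%N) (hr : 0 <= r < T1)
    (hT2 : T2 = n%:R * T1 + r) (hdelta : 0 < delta) (hm : (1 <= m)%N) :
  (* the recursion is rewritten as the first-order (x_1,z)-system, whose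
     (max,+) matrix is x_matrix *)
  (forall l : nat, (1 <= l)%N ->
     (forall x1 : int -> \bar R,
        x_recursion T1 T2 l x1 <->
        exists z : nat -> int -> \bar R, x_system T1 r n l x1 z) /\
     (forall (x1 : int -> \bar R) (z : nat -> int -> \bar R),
        x_system T1 r n l x1 z <->
        mp_linear_system (x_matrix T1 r n l) (x_state l x1 z))) /\
  (* y_matrix is the (max,+) matrix of the y-system *)
  (forall y : nat -> int -> \bar R,
     y_system delta m y <->
     mp_linear_system (y_matrix delta m) (y_state m y)) /\
  (* lambda_2 *)
  is_max_cycle_mean (y_matrix delta m) delta /\
  (* lambda_1 *)
  (forall l : nat, (1 <= l)%N ->
     is_max_cycle_mean (x_matrix T1 r n l)
       (if (n < l)%N then T1 else (n.+1%:R * T1 + r) / l.+1%:R)) /\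
  (* the minimum of lambda_1 over l >= 1 is T1, attained for every l > n *)
  (forall (l : nat) (lambda1 : R), (1 <= l)%N ->
     is_max_cycle_mean (x_matrix T1 r n l) lambda1 -> T1 <= lambda1) /\
  (forall l : nat, (n < l)%N -> is_max_cycle_mean (x_matrix T1 r n l) T1).
Proof.
have [r_ge0 r_lt] := andP hr.
have lambda1_loop l : (n < l)%N -> is_max_cycle_mean (x_matrix T1 r n l) T1.
  move=> lt_nl; apply: x_max_cycle_mean_of_loop.
    exact: leq_ltn_trans lt_nl.
  have : n.+2%:R * T1 <= l.+1%:R * T1 by rewrite ler_pM2r // ler_nat.
  by rewrite (mulr_succl n.+1); lra.
split=> [l l_gt0|]; first by split=> *; [apply: x_recursionP|apply: x_systemP].
split=> [y|]; first exact: y_systemP.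
split; first exact: y_max_cycle_mean.
split=> [l l_gt0|].
  case: ltnP => [/lambda1_loop //|le_ln].
  apply: x_max_cycle_mean_of_hamiltonian => //.
  have : l.+1%:R * T1 <= n.+1%:R * T1 by rewrite ler_pM2r // ler_nat.
  by lra.
by split=> // l lambda1 l_gt0; apply: x_max_cycle_mean_ge.
Qed.
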